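(* Assume $\beta=\gamma$, and let $\delta>0$ be so small that $\alpha_1+\delta$ has the same sign as $\alpha_1$, $\beta-\delta>0$, $\gamma-\delta>0$, and $$\vartheta := \frac{L_f}{|\alpha_1|}\,\frac{e^{\alpha_1 h}-1}{e^{(\alpha_1+\delta)h}-1} + \frac{L_g}{\beta}\,\frac{1-e^{-\beta h}}{1-e^{-(\beta-\delta)h}} < 1 .$$ Let $y=\{y_i\}_{i\ge0}$, $y_i = e^{-i\delta h}x_i$, which is the solution of $$y_i = b_i(\delta) + \frac{1}{\alpha_1}\sum_{j=0}^{i-1}\omega_{ij}(\delta)\Phi_{ij}(y_j) + \frac{1}{\beta}\sum_{j=i}^{\infty}\varphi_{ij}(\delta)\Psi_{ij}(y_j),\quad i\ge 0,$$ and let $y_N = (y_{N,i})_{0\le i\le N}$ be the solution of the truncated system $$y_{N,i} = b_i(\delta) + \frac{1}{\alpha_1}\sum_{j=0}^{i-1}\omega_{ij}(\delta)\Phi_{ij}(y_{N,j}) + \frac{1}{\beta}\sum_{j=i}^{N}\varphi_{ij}(\delta)\Psi_{ij}(y_{N,j}),\quad 0\le i\le N.$$ Then the truncated solutions $y_N$ converge uniformly to the exact solution $y$, in the sense that the extensions $(y_N)$, defined by $(y_N)_i = y_{N,i}$ for $i\le N$ and $(y_N)_i=0$ for $i\ge N+1$, satisfy $$\lim_{N\to\infty}\|(y_N)-y\|_\infty = 0,$$ where $\|z\|_\infty=\sup_{i\ge0}|z_i|$.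
   Context: Fix a norm $|\cdot|$ on $\mathbb{R}^n$ and a step size $h>0$. The real constants $\alpha_1,\alpha_2,\beta,\gamma$ satisfy $\alpha_1 \ne 0$, $\alpha_2 \ge 0$, $\alpha_1 \le \alpha_2$, $\beta > 0$, $\beta \ge \gamma$. The data are a function $x_0:[0,\infty)\to\mathbb{R}^n$ and $\mathbb{R}^n$-valued functions $f(t,s,x)$, defined for $0\le s\le t<\infty$, $x\in S$, and $g(t,s,x)$, defined for $0\le t\le s<\infty$, $x\in S$. Standing assumptions: (i) $f$ and $g$ are Lipschitz in $x\in S$ uniformly in $(t,s)$ in their respective domains, with Lipschitz constants $L_f$, $L_g$ satisfying $\frac{L_f}{|\alpha_1|} + \frac{L_g}{\beta} < 1$. (ii) $f$ and $g$ are continuous in all their arguments on their respective domains, and $|f|\le C_f$, $|g|\le C_g$ there, for constants $C_f,C_g$. (iii) $S = \{x\in\mathbb{R}^n : |x| \le \|x_0\|_\infty + \frac{C_f}{|\alpha_1|} + \frac{C_g}{\beta}\}$, where $\|x_0\|_\infty=\sup_{t\ge 0}|x_0(t)|$. (iv) $f$ and $g$ are continuously differentiable in $s$ and in $t$ on their respective domains, with bounded partial derivatives. (v) $x_0(\cdot)$ is bounded and differentiable with bounded derivative on $[0,\infty)$. Notation: $b_i = x_0(ih)$, $F_{ij}(\xi) = f(ih,jh,\xi)$ for $0\le j\le i-1$, $G_{ij}(\xi) = g(ih,jh,\xi)$ for $j\ge i$ (with $\xi\in S$), and $$\omega_{ij} = e^{(\alpha_1 j-\alpha_2 i)h}\,[e^{\alpha_1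 h}-1], \qquad \varphi_{ij} = e^{(-\beta j+\gamma i)h}\,[1-e^{-\beta h}].$$ The sequence $x=\{x_i\}_{i\ge0}$ is the unique $S$-valued solution of $$x_i = b_i + \sum_{j=0}^{i-1} \frac{1}{\alpha_1}\omega_{ij}F_{ij}(x_j) + \sum_{j=i}^{\infty}\frac{1}{\beta}\varphi_{ij}G_{ij}(x_j), \quad i\ge 0.$$ For $\delta>0$ set $b_i(\delta) = e^{-i\delta h}b_i$, $\omega_{ij}(\delta)=\omega_{ij}e^{(j-i)\delta h}$, $\varphi_{ij}(\delta)=\varphi_{ij}e^{(j-i)\delta h}$, $\Phi_{ij}(\eta)=e^{-j\delta h}F_{ij}(e^{j\delta h}\eta)$, $\Psi_{ij}(\eta)=e^{-j\delta h}G_{ij}(e^{j\delta h}\eta)$, for $\eta$ with $e^{j\delta h}\eta\in S$. The solution of the $y$-system is the unique one with $e^{i\delta h}y_i\in S$ for all $i$, and the solution of the truncated $y$-system is the unique one with $e^{i\delta h}y_{N,i}\in S$ for $0\le i\le N$. Empty sums are zero. *)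

(* Defs.v *)
From HB Require Import structures.
From mathcomp Require Import all_boot all_order all_algebra.
From mathcomp Require Import all_classical all_reals all_analysis.

Set Implicit Arguments.
Unset Strict Implicit.
Unset Printing Implicit Defensive.

Import Order.TTheory GRing.Theory Num.Theory.
Import numFieldNormedType.Exports.

Local Open Scope classical_set_scope.
Local Open Scope ring_scope.

Section Norms.
Context {R : realType} {n : nat}.

(* The canonical `|x| on 'rV[R]_n is the max norm, so an arbitrary norm is
   an explicit function.  All norms on 'rV[R]_n induce the library topology,
   which is the one used for every limit and continuity statement below. *)
Record is_norm (nrm : 'rV[R]_n -> R) : Prop := IsNorm {
  norm_triangle : forall x y, nrm (x + y) <= nrm x + nrm y ;
  norm_homog : forall (a : R) x, nrm (a *: x) = `|a| * nrm x ;
  norm_definite : forall x, nrm x = 0 -> x = 0 }.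

(* Valued in \bar R: the real-valued sup of an unbounded set is 0. *)
Definition supnorm (nrm : 'rV[R]_n -> R) {T : Type} (D : set T)
    (z : T -> 'rV[R]_n) : \bar R :=
  ereal_sup [set (nrm (z t))%:E | t in D].

Definition bounded_on (nrm : 'rV[R]_n -> R) {T : Type} (D : set T)
    (z : T -> 'rV[R]_n) : Prop :=
  exists M : R, forall t, D t -> nrm (z t) <= M.

(* One-sided at the end points of an interval D; void when D = [set t]. *)
Definition deriv_within (D : set R) (u : R -> 'rV[R]_n) (t : R)
    (l : 'rV[R]_n) : Prop :=
  (s - t)^-1 *: (u s - u t) @[s --> within D t^'] --> l.

Definition differentiable_bounded (nrm : 'rV[R]_n -> R) (D : set R)
    (u : R -> 'rV[R]_n) : Prop :=
  exists u' : R -> 'rV[R]_n,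
    (forall t, D t -> deriv_within D u t (u' t)) /\ bounded_on nrm D u'.

End Norms.

Section Kernels.
Context {R : realType} {n : nat}.

(* Sets of pairs (t, s). *)
Definition lower_dom : set (R * R) := [set p | 0 <= p.2 <= p.1].
Definition upper_dom : set (R * R) := [set p | 0 <= p.1 <= p.2].

Implicit Types (nrm : 'rV[R]_n -> R) (D : set (R * R)) (S : set 'rV[R]_n).
Implicit Types k : R -> R -> 'rV[R]_n -> 'rV[R]_n.

Definition uncurry3 k (p : R * R * 'rV[R]_n) : 'rV[R]_n := k p.1.1 p.1.2 p.2.

Definition lipschitz_in_x nrm D S k (L : R) : Prop :=
  forall t s x y, D (t, s) -> S x -> S y ->
    nrm (k t s x - k t s y) <= L * nrm (x - y).

Definition continuous_kernel D S k : Prop :=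
  {within D `*` S, continuous (uncurry3 k)}.

Definition C1_bounded nrm D S k : Prop :=
  exists kt ks : R -> R -> 'rV[R]_n -> 'rV[R]_n,
  [/\ forall t s x, D (t, s) -> S x ->
        deriv_within [set t' | D (t', s)] (fun t' => k t' s x) t (kt t s x) /\
        deriv_within [set s' | D (t, s')] (fun s' => k t s' x) s (ks t s x),
      continuous_kernel D S kt /\ continuous_kernel D S ks
    & bounded_on nrm (D `*` S) (uncurry3 kt) /\
      bounded_on nrm (D `*` S) (uncurry3 ks)].

End Kernels.

Section Systems.
Context {R : realType} {n : nat}.
Local Notation V := 'rV[R]_n.

Definition omega (alpha1 alpha2 h : R) (i j : nat) : R :=
  expR ((alpha1 * j%:R - alpha2 * i%:R) * h) * (expR (alpha1 * h) - 1).

Definition phi (beta gamma h : R) (i j : nat) : R :=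
  expR ((- beta * j%:R + gamma * i%:R) * h) * (1 - expR (- beta * h)).

Definition sample (k : R -> R -> V -> V) (h : R) (i j : nat) (xi : V) : V :=
  k (i%:R * h) (j%:R * h) xi.

Definition damp (delta h : R) (i : nat) (x : V) : V :=
  expR (- (i%:R * delta * h)) *: x.

Definition undamp (delta h : R) (i : nat) (y : V) : V :=
  expR (i%:R * delta * h) *: y.

Definition weight_damp (delta h : R) (w : nat -> nat -> R) (i j : nat) : R :=
  w i j * expR ((j%:R - i%:R) * delta * h).

Definition kernel_damp (delta h : R) (K : nat -> nat -> V -> V) (i j : nat)
    (eta : V) : V :=
  damp delta h j (K i j (undamp delta h j eta)).

(* The infinite sum is read as convergence of its partial sums:
   x_i = b_i + a^-1 sum_(j < i) w_ij F_ij(x_j)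
             + c^-1 lim_m sum_(i <= j < m) p_ij G_ij(x_j). *)
Definition solves (a c : R) (b : nat -> V)
    (w : nat -> nat -> R) (F : nat -> nat -> V -> V)
    (p : nat -> nat -> R) (G : nat -> nat -> V -> V) (x : nat -> V) : Prop :=
  forall i, (fun m => b i + a^-1 *: \sum_(0 <= j < i) w i j *: F i j (x j)
                          + c^-1 *: \sum_(i <= j < m) p i j *: G i j (x j))
            @ \oo --> x i.

Definition solves_trunc (a c : R) (b : nat -> V)
    (w : nat -> nat -> R) (F : nat -> nat -> V -> V)
    (p : nat -> nat -> R) (G : nat -> nat -> V -> V)
    (N : nat) (y : 'I_N.+1 -> V) : Prop :=
  forall i, y i = b i
    + a^-1 *: \sum_(j < N.+1 | (j < i)%N) w i j *: F i j (y j)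
    + c^-1 *: \sum_(j < N.+1 | (i <= j)%N) p i j *: G i j (y j).

Definition extend0 (N : nat) (y : 'I_N.+1 -> V) (i : nat) : V :=
  if insub i is Some k then y k else 0.

End Systems.

(* Main.v *)
Require Import Defs.
From HB Require Import structures.
From mathcomp Require Import all_boot all_order all_algebra.
From mathcomp Require Import all_classical all_reals all_analysis.
From mathcomp Require Import ring lra.

Set Implicit Arguments.
Unset Strict Implicit.
Unset Printing Implicit Defensive.

Import Order.TTheory GRing.Theory Num.Theory.
Import numFieldNormedType.Exports.

Local Open Scope classical_set_scope.
Local Open Scope ring_scope.

(** Damping by [exp (- delta h i)] is a bijection between solutions of the
    original and of the damped system, so [y] solves the latter
    ([solves_damp]).  The damped kernels keep the Lipschitz constants
    ([kernel_damp_lip]), and only the row sums of the weights change: since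
    the weights are geometric, they are bounded by the two quotients that occur
    in [theta] ([sum_omega_damp], [sum_phi_damp]).  Hence the right-hand side of
    the damped system, and of each of its truncations, contracts the sup norm
    with factor [theta < 1] ([partial_rhs_contract]); uniqueness follows.

    The gain of the damping is in the tail of the infinite sum.  When
    [beta = gamma] the undamped tail does not become small uniformly in the row
    [i <= N] (at [i = N] it only starts), but the damped kernel [Psi_ij] carries a
    factor [exp (- delta h j)], which is at most [exp (- delta h (N + 1))] for
    every [j > N].  So truncation at [N] changes each of the rows [i <= N] by
    O([exp (- delta h (N + 1))]), and the contraction turns this consistency error
    into an error of the same order ([trunc_error]).  The entries [y_i] with
    [i > N], which the extension replaces by [0], are of that order too, because
    [S] is bounded. *)

(** * Arbitrary norms on row vectors *)

Section NormFacts.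
Context {R : realType} {n : nat} {nrm : 'rV[R]_n -> R} (hnrm : is_norm nrm).

Lemma nrm0 : nrm 0 = 0.
Proof. by rewrite -(scale0r 0) (norm_homog hnrm) normr0 mul0r. Qed.

Lemma nrmN v : nrm (- v) = nrm v.
Proof. by rewrite -scaleN1r (norm_homog hnrm) normrN1 mul1r. Qed.

Lemma nrm_ge0 v : 0 <= nrm v.
Proof.
have := norm_triangle hnrm v (- v); rewrite subrr nrm0 nrmN -mulr2n.
by rewrite pmulrn_lge0.
Qed.

Lemma nrm_sum (I : Type) (r : seq I) (P : pred I) (v : I -> 'rV[R]_n) :
  nrm (\sum_(i <- r | P i) v i) <= \sum_(i <- r | P i) nrm (v i).
Proof.
apply: (big_ind2 (fun a b => nrm a <= b)) => //; first by rewrite nrm0.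
move=> a b c d ab cd; exact: (le_trans (norm_triangle hnrm _ _) (lerD ab cd)).
Qed.

(** Common estimate for the two sums of the system and for the tail that is cut
    off by truncation: uniform bound on the terms times the total weight. *)
Lemma nrm_wsum (w : nat -> R) (v : nat -> 'rV[R]_n) (m1 m2 : nat) (A C : R) :
  0 <= C ->
  (forall j, (m1 <= j < m2)%N -> nrm (v j) <= C) ->
  \sum_(m1 <= j < m2) `|w j| <= A ->
  nrm (\sum_(m1 <= j < m2) w j *: v j) <= C * A.
Proof.
move=> C0 hv hA; apply: le_trans (nrm_sum _ _ _) _.
apply: (@le_trans _ _ (\sum_(m1 <= j < m2) C * `|w j|)); last first.
  by rewrite -mulr_sumr ler_wpM2l.
rewrite [leLHS]big_nat_cond [leRHS]big_nat_cond ler_sum // => j.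
rewrite andbT => /hv vj.
by rewrite (norm_homog hnrm) mulrC ler_wpM2r.
Qed.

(** Every norm is dominated by the max norm, hence is continuous for the
    ambient topology. *)
Lemma nrm_le_mx_norm : exists2 K : R, 0 < K & forall v, nrm v <= K * `|v|.
Proof.
exists (1 + \sum_(j < n) nrm (delta_mx 0 j)).
  by rewrite ltr_pwDl // sumr_ge0 // => j _; exact: nrm_ge0.
move=> v; rewrite mulrDl mul1r ler_wpDl //.
rewrite {1}(row_sum_delta v); apply: le_trans (nrm_sum _ _ _) _.
rewrite mulr_suml; apply: ler_sum => j _.
rewrite (norm_homog hnrm) mulrC ler_wpM2l ?nrm_ge0 //.
rewrite [leRHS]mx_normrE.
exact: (le_bigmax _ (fun ij : 'I_1 * 'I_n => `|v ij.1 ij.2|) (0, j)).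
Qed.

(** This is how estimates on partial sums pass to solutions of the infinite
    system, which are defined as limits in the ambient topology. *)
Lemma nrm_lim_le (u : nat -> 'rV[R]_n) (l : 'rV[R]_n) (c : R) (m0 : nat) :
  u @ \oo --> l -> (forall m, (m0 <= m)%N -> nrm (u m) <= c) -> nrm l <= c.
Proof.
move=> /cvgrPdist_lt ul uc; apply/ler_addgt0Pr => e e0.
have [K K0 hK] := nrm_le_mx_norm.
have [m1 _ hm1] := ul _ (divr_gt0 e0 K0).
pose m := maxn m0 m1.
rewrite -[l](subrK (u m)) addrC [u m + _]addrC.
apply: le_trans (norm_triangle hnrm _ _) _; rewrite addrC lerD //.
  by rewrite uc // leq_maxl.
apply: le_trans (hK _) _; rewrite mulrC -ler_pdivlMr // ltW // hm1 //=.
exact: leq_maxr.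
Qed.

End NormFacts.

(** The supremum of [d] is itself a bound, so the hypothesis gives
    [sup d <= th * sup d + T].  A crude bound [M] makes this supremum finite. *)
Lemma self_improving_bound (R : realType) (I : Type) (d : I -> R) (M th T : R) :
  th < 1 -> (forall i, 0 <= d i <= M) ->
  (forall E, (forall i, d i <= E) -> 0 <= E ->
     forall i, d i <= th * E + T) ->
  forall i, d i <= T / (1 - th).
Proof.
move=> th1 dM imp i.
have ub : has_ubound (range d).
  by exists M => _ [j _ <-]; have /andP[] := dM j.
have le_sup j : d j <= sup (range d) by apply: (ub_le_sup ub); exists j.
apply: le_trans (le_sup i) _.
have th1' : 0 < 1 - th by rewrite subr_gt0.
rewrite ler_pdivlMr // mulrBr mulr1 lerBlDl mulrC.
apply: ge_sup; first by exists (d i); exists i.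
move=> _ [j _ <-]; apply: imp => //.
by apply: le_trans (le_sup i); have /andP[] := dM i.
Qed.

(** * Contractive discrete systems and their truncation *)

Section DiscreteSystem.
Context {R : realType} {n : nat}.
Local Notation V := 'rV[R]_n.
Context {nrm : V -> R} (hnrm : is_norm nrm).
Context (a c : R) (b : nat -> V).
Context (w : nat -> nat -> R) (F : nat -> nat -> V -> V).
Context (p : nat -> nat -> R) (G : nat -> nat -> V -> V).

Definition partial_rhs (m : nat) (z : nat -> V) (i : nat) : V :=
  b i + a^-1 *: \sum_(0 <= j < i) w i j *: F i j (z j)
      + c^-1 *: \sum_(i <= j < m) p i j *: G i j (z j).

(** The truncated system is the partial sum at [N.+1] of the infinite one, which
    makes both comparable through the same right-hand side. *)
Lemma solves_truncE N (y : 'I_N.+1 -> V) i : (i <= N)%N ->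
  solves_trunc a c b w F p G y ->
  extend0 y i = partial_rhs N.+1 (extend0 y) i.
Proof.
rewrite -ltnS => iN ysol.
have ext (k : 'I_N.+1) : extend0 y k = y k by rewrite /extend0 valK.
rewrite (ext (Ordinal iN)) ysol /partial_rhs /=; congr (_ + _ *: _ + _ *: _).
  rewrite (big_nat_widen _ _ N.+1) ?(ltnW iN) // big_mkord.
  by apply: eq_bigr => j _; rewrite ext.
by rewrite big_geq_mkord; apply: eq_bigr => j _; rewrite ext.
Qed.

Context (D : nat -> set V) (Lf Lg A B M : R).
Hypothesis lipF : forall i j xi eta, (j < i)%N -> D j xi -> D j eta ->
  nrm (F i j xi - F i j eta) <= Lf * nrm (xi - eta).
Hypothesis lipG : forall i j xi eta, (i <= j)%N -> D j xi -> D j eta ->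
  nrm (G i j xi - G i j eta) <= Lg * nrm (xi - eta).
Hypotheses (Lf_ge0 : 0 <= Lf) (Lg_ge0 : 0 <= Lg).
Hypothesis sum_w : forall i, \sum_(0 <= j < i) `|w i j| <= A.
Hypothesis sum_p : forall i m, \sum_(i <= j < m) `|p i j| <= B.
Hypothesis boundD : forall j xi, D j xi -> nrm xi <= M.

Let th := Lf / `|a| * A + Lg / `|c| * B.
Hypothesis th_lt1 : th < 1.

(** The constant [th] is the contraction factor: row sums of the weights
    times Lipschitz constants. *)
Lemma partial_rhs_contract m z z' i E :
  (i < m)%N -> (forall j, (j < m)%N -> D j (z j)) ->
  (forall j, (j < m)%N -> D j (z' j)) ->
  (forall j, (j < m)%N -> nrm (z j - z' j) <= E) ->
  nrm (partial_rhs m z i - partial_rhs m z' i) <= th * E.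
Proof.
move=> im Dz Dz' zE.
have E0 : 0 <= E := le_trans (nrm_ge0 hnrm _) (zE i im).
rewrite /partial_rhs !opprD addrACA [X in X + _]addrACA subrr add0r -!scalerBr.
rewrite -!sumrB; under eq_bigr do rewrite -scalerBr.
under [X in _ + _ *: X]eq_bigr do rewrite -scalerBr.
apply: le_trans (norm_triangle hnrm _ _) _.
rewrite !(norm_homog hnrm) /th mulrDl; apply: lerD.
  rewrite normfV [leRHS](_ : _ = `|a|^-1 * (Lf * E * A)); last by ring.
  rewrite ler_wpM2l ?invr_ge0 //; apply: (nrm_wsum hnrm) => //.
    by rewrite mulr_ge0.
  move=> j /andP[_ ji]; have jm := ltn_trans ji im.
  apply: le_trans (lipF _ _ _) _; [exact: ji|exact: Dz|exact: Dz'|].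
  by rewrite ler_wpM2l // zE.
rewrite normfV [leRHS](_ : _ = `|c|^-1 * (Lg * E * B)); last by ring.
  rewrite ler_wpM2l ?invr_ge0 //; apply: (nrm_wsum hnrm) => //.
  by rewrite mulr_ge0.
move=> j /andP[ij jm].
apply: le_trans (lipG _ _ _) _; [exact: ij|exact: Dz|exact: Dz'|].
by rewrite ler_wpM2l // zE.
Qed.

Lemma solves_unique z z' :
  (forall i, D i (z i)) -> (forall i, D i (z' i)) ->
  solves a c b w F p G z -> solves a c b w F p G z' -> z = z'.
Proof.
move=> Dz Dz' solz solz'; apply/funext => i.
apply/eqP; rewrite -subr_eq0; apply/eqP; apply: (norm_definite hnrm).
apply/eqP; rewrite eq_le (nrm_ge0 hnrm) andbT.
rewrite -(mul0r (1 - th)^-1).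
apply: (@self_improving_bound _ _ (fun i => nrm (z i - z' i)) (M + M)) => //.
  move=> j; rewrite (nrm_ge0 hnrm) /=.
  apply: le_trans (norm_triangle hnrm _ _) _; rewrite (nrmN hnrm).
  by rewrite lerD // (boundD (j := j)).
move=> E dE _ j; rewrite addr0.
apply: (nrm_lim_le hnrm (cvgB (solz j) (solz' j)) (m0 := j.+1)) => m jm.
exact: partial_rhs_contract.
Qed.

(** Truncating at [N] perturbs the equations by the tail of the second sum,
    and the contraction amplifies this consistency error by at most
    [1 / (1 - th)]. *)
Lemma trunc_error N T z (y : 'I_N.+1 -> V) :
  (forall i, D i (z i)) -> (forall i : 'I_N.+1, D i (y i)) ->
  solves a c b w F p G z -> solves_trunc a c b w F p G y ->
  0 <= T ->
  (forall i j, (i <= N < j)%N -> nrm (G i j (z j)) <= T) ->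
  forall i, (i <= N)%N ->
    nrm (extend0 y i - z i) <= (B * T / `|c|) / (1 - th).
Proof.
move=> Dz Dy solz soly T0 GT.
have Dext j : (j < N.+1)%N -> D j (extend0 y j).
  by move=> jN; rewrite /extend0 insubT; exact: (Dy (Ordinal jN)).
suff bnd (k : 'I_N.+1) :
    nrm (extend0 y k - z k) <= (B * T / `|c|) / (1 - th).
  by move=> i iN; exact: (bnd (Ordinal (iN : (i < N.+1)%N))).
apply: (@self_improving_bound _ _
  (fun k : 'I_N.+1 => nrm (extend0 y k - z k)) (M + M)) => //.
  move=> {}k; rewrite (nrm_ge0 hnrm) /=.
  apply: le_trans (norm_triangle hnrm _ _) _; rewrite (nrmN hnrm).
  by apply: lerD; apply: (boundD (j := k)) => //; exact: Dext.
move=> E dE E0 {}k; have kN : (k < N.+1)%N by [].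
have lim : extend0 y k - partial_rhs m z k @[m --> \oo] -->
    extend0 y k - z k.
  by apply: cvgB; [exact: cvg_cst | exact: solz].
apply: (nrm_lim_le hnrm lim (m0 := N.+1)) => m Nm.
rewrite (solves_truncE _ soly) //.
(* The insertion of the right-hand side at [N.+1] evaluated at [z] separates
   the contraction part from the consistency error. *)
rewrite -(subrK (partial_rhs N.+1 z k) (partial_rhs N.+1 _ k)) -addrA.
apply: le_trans (norm_triangle hnrm _ _) _; apply: lerD.
  apply: partial_rhs_contract => // j jN; exact: (dE (Ordinal jN)).
rewrite /partial_rhs opprD addrACA subrr add0r -scalerBr.
rewrite (big_cat_nat (n := N.+1) (p := m)) //=; last exact: ltnW.
rewrite opprD addrA subrr add0r (norm_homog hnrm) (nrmN hnrm) normfV mulrC.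
rewrite ler_wpM2r ?invr_ge0 // (mulrC B); apply: (nrm_wsum hnrm) => //.
  by move=> j /andP[Nj _]; rewrite GT // Nj -ltnS kN.
(* The weights with [N < j < m] are among those with [k <= j < m], so the row
   sum bounds them as well. *)
apply: le_trans (sum_p k m).
rewrite (big_cat_nat (n := N.+1) (m := k)) //=; last exact: ltnW.
by rewrite lerDr sumr_ge0.
Qed.

End DiscreteSystem.

(** * Row sums of the damped weights *)

Section Weights.
Context {R : realType} (alpha1 alpha2 beta delta h : R).
Hypotheses (h_gt0 : 0 < h) (delta_gt0 : 0 < delta).

(** The row sum is geometric, and after multiplication by [|q - 1|] with
    [q = exp ((alpha1 + delta) h)] it telescopes to a difference of two
    exponentials lying in [[0, 1]], because [0] and [alpha1] are both at most
    [alpha2].  This settles growing and decaying weights at once. *)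
Lemma sum_omega_damp i :
  alpha1 != 0 -> 0 <= alpha2 -> alpha1 <= alpha2 ->
  Num.sg (alpha1 + delta) = Num.sg alpha1 ->
  \sum_(0 <= j < i) `|weight_damp delta h (omega alpha1 alpha2 h) i j|
    <= (expR (alpha1 * h) - 1) / (expR ((alpha1 + delta) * h) - 1).
Proof.
move=> a1 a2 a12 sga; set q := expR ((alpha1 + delta) * h).
pose e := expR (- (alpha2 + delta) * h * i%:R).
have weightE j : weight_damp delta h (omega alpha1 alpha2 h) i j =
    (expR (alpha1 * h) - 1) * e * q ^+ j.
  rewrite /weight_damp /omega mulrAC -expRD /q -expRM_natl -[RHS]mulrA -expRD.
  by rewrite [LHS]mulrC; congr (_ * expR _); ring.
(* The hypothesis on signs makes numerator and denominator of equal sign. *)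
have ratio : (expR (alpha1 * h) - 1) / (q - 1) =
    `|expR (alpha1 * h) - 1| / `|q - 1| /\ 0 < `|q - 1|.
  have [a0|a0|a0] := ltrgtP 0 alpha1; last by rewrite -a0 eqxx in a1.
    have q1 : 1 < q by rewrite /q expR_gt1 mulr_gt0 // addr_gt0.
    have p1 : 1 < expR (alpha1 * h) by rewrite expR_gt1 mulr_gt0.
    by rewrite !gtr0_norm ?subr_gt0.
  have ad0 : alpha1 + delta < 0 by rewrite -sgr_lt0 sga sgr_lt0.
  have q1 : q < 1 by rewrite /q expR_lt1 nmulr_rlt0.
  have p1 : expR (alpha1 * h) < 1 by rewrite expR_lt1 nmulr_rlt0.
  rewrite !ltr0_norm ?subr_lt0 // oppr_gt0 subr_lt0; split=> //.
  by rewrite invrN mulrNN.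
case: ratio => -> q1.
have sumq0 : 0 <= \sum_(0 <= j < i) q ^+ j.
  by rewrite sumr_ge0 // => j _; rewrite exprn_ge0 ?expR_ge0.
under eq_bigr => j _.
  rewrite weightE -mulrA normrM (ger0_norm (_ : 0 <= e * q ^+ j)); last first.
    by rewrite mulr_ge0 ?exprn_ge0 ?expR_ge0.
  over.
rewrite -!mulr_sumr ler_wpM2l // -div1r ler_pdivlMr //.
rewrite -[leLHS]ger0_norm; last by rewrite !mulr_ge0 ?expR_ge0 ?(ltW q1).
rewrite normrM normr_id -normrM big_mkord -mulrA.
rewrite [X in e * X]mulrC -subrX1 mulrBr mulr1.
have e01 : 0 <= e <= 1.
  by rewrite expR_ge0 /= expR_le1 !mulNr oppr_le0 !mulr_ge0 ?addr_ge0 // ltW.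
have eq01 : 0 <= e * q ^+ i <= 1.
  rewrite /e /q -expRM_natl -expRD expR_ge0 expR_le1 /=.
  rewrite (_ : _ + _ = - ((alpha2 - alpha1) * h * i%:R)); last by ring.
  by rewrite oppr_le0 !mulr_ge0 ?subr_ge0 // ltW.
by rewrite ler_norml; apply/andP; split; lra.
Qed.

(** With equal rates the weight depends on [j - i] only, so the row is the
    beginning of a geometric series of ratio [exp (- (beta - delta) h) < 1]. *)
Lemma sum_phi_damp i m : 0 < beta - delta ->
  \sum_(i <= j < m) `|weight_damp delta h (phi beta beta h) i j|
    <= (1 - expR (- beta * h)) / (1 - expR (- (beta - delta) * h)).
Proof.
move=> bd; set q := expR (- (beta - delta) * h).
have q1 : q < 1 by rewrite expR_lt1 mulNr oppr_lt0 mulr_gt0.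
have b0 : 0 < beta by rewrite (lt_trans delta_gt0) // -subr_gt0.
have p1 : expR (- beta * h) < 1 by rewrite expR_lt1 mulNr oppr_lt0 mulr_gt0.
rewrite -{1}(add0n i) big_addn.
have weightE j : `|weight_damp delta h (phi beta beta h) i (j + i)| =
    (1 - expR (- beta * h)) * q ^+ j.
  rewrite /weight_damp /phi mulrAC -expRD /q -expRM_natl natrD mulrC.
  rewrite ger0_norm ?mulr_ge0 ?expR_ge0 ?subr_ge0 ?(ltW p1) //.
  by congr (_ * expR _); ring.
under eq_bigr do rewrite weightE.
rewrite -mulr_sumr ler_wpM2l ?subr_ge0 ?(ltW p1) //.
rewrite -div1r ler_pdivlMr ?subr_gt0 // big_mkord -[1 - q]opprB mulrN mulrC.
by rewrite -subrX1 opprB lerBlDr lerDl exprn_ge0 ?expR_ge0.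
Qed.

End Weights.

(** * Damping of systems, kernels and weights *)

Section Damping.
Context {R : realType} {n : nat}.
Local Notation V := 'rV[R]_n.
Context (nrm : V -> R) (hnrm : is_norm nrm) (delta h : R).
Hypotheses (h_gt0 : 0 < h) (delta_gt0 : 0 < delta).

Lemma dampK i : cancel (@damp R n delta h i) (undamp delta h i).
Proof. by move=> v; rewrite /damp /undamp scalerA -expRD subrr expR0 scale1r. Qed.

Lemma undampK i : cancel (@undamp R n delta h i) (damp delta h i).
Proof. by move=> v; rewrite /damp /undamp scalerA -expRD addNr expR0 scale1r. Qed.

Lemma nrm_damp i v :
  nrm (damp delta h i v) = expR (- (delta * h)) ^+ i * nrm v.
Proof.
rewrite (norm_homog hnrm) ger0_norm ?expR_ge0 // -expRM_natl.
by congr (expR _ * _); ring.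
Qed.

Lemma damp_ratio_itv : 0 < expR (- (delta * h)) < 1.
Proof. by rewrite expR_gt0 expR_lt1 oppr_lt0 mulr_gt0. Qed.

Lemma nrm_damp_le i N v : (N <= i)%N ->
  nrm (damp delta h i v) <= expR (- (delta * h)) ^+ N * nrm v.
Proof.
move=> Ni; rewrite nrm_damp ler_wpM2r ?(nrm_ge0 hnrm) //.
have /andP[r0 r1] := damp_ratio_itv.
by rewrite ler_wiXn2l // ltW.
Qed.

(** The contraction by [damp] outside the kernel undoes the expansion by
    [undamp] inside, so the Lipschitz constant is unchanged. *)
Lemma kernel_damp_lip (K : nat -> nat -> V -> V) (S : set V) (L : R) i j :
  (forall xi eta, S xi -> S eta ->
     nrm (K i j xi - K i j eta) <= L * nrm (xi - eta)) ->
  forall xi eta, S (undamp delta h j xi) -> S (undamp delta h j eta) ->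
    nrm (kernel_damp delta h K i j xi - kernel_damp delta h K i j eta)
      <= L * nrm (xi - eta).
Proof.
move=> lipK xi eta Sxi Seta.
rewrite -[xi - eta](undampK j) nrm_damp /kernel_damp /damp -scalerBr.
rewrite -/(damp delta h j _) nrm_damp mulrCA ler_wpM2l ?exprn_ge0 ?expR_ge0 //.
by rewrite /undamp scalerBr; exact: lipK.
Qed.

Lemma weight_kernel_damp (w : nat -> nat -> R) (K : nat -> nat -> V -> V) i j v :
  weight_damp delta h w i j *: kernel_damp delta h K i j (damp delta h j v)
  = damp delta h i (w i j *: K i j v).
Proof.
rewrite /kernel_damp dampK /damp /weight_damp !scalerA -mulrA mulrC -expRD.
by congr (expR _ * _ *: _); ring.
Qed.

Lemma solves_damp (a c : R) (b : nat -> V) w F p G (x : nat -> V) :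
  solves a c b w F p G x ->
  solves a c (fun i => damp delta h i (b i))
    (weight_damp delta h w) (kernel_damp delta h F)
    (weight_damp delta h p) (kernel_damp delta h G)
    (fun i => damp delta h i (x i)).
Proof.
move=> solx i.
have rhsE m : partial_rhs a c (fun i => damp delta h i (b i))
    (weight_damp delta h w) (kernel_damp delta h F)
    (weight_damp delta h p) (kernel_damp delta h G) m
    (fun i => damp delta h i (x i)) i
    = damp delta h i (partial_rhs a c b w F p G m x i).
  rewrite /partial_rhs /damp !scalerDr -/(damp delta h i (b i)).
  congr (_ + _ + _); rewrite scalerA mulrC -scalerA.
    congr (_ *: _); rewrite scaler_sumr; apply: eq_bigr => j _.
    exact: weight_kernel_damp.
  congr (_ *: _); rewrite scaler_sumr; apply: eq_bigr => j _.
  exact: weight_kernel_damp.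
have lim : damp delta h i (partial_rhs a c b w F p G m x i) @[m --> \oo]
    --> damp delta h i (x i) by apply: cvgZl_tmp; exact: solx.
by rewrite -(eq_cvg _ _ rhsE) in lim.
Qed.

End Damping.

(** * Convergence of the truncated solutions *)

(** The radius that defines the state space is an extended real; boundedness of
    the data makes it at most a real number. *)
Lemma bounded_state_ball (R : realType) (n : nat) (nrm : 'rV[R]_n -> R)
    (T : Type) (D : set T) (z : T -> 'rV[R]_n) (C : R) :
  bounded_on nrm D z ->
  exists M, forall x,
    ((nrm x)%:E <= supnorm nrm D z + C%:E)%E -> nrm x <= M.
Proof.
move=> [M0 hM0]; exists (M0 + C) => x xle.
rewrite -lee_fin; apply: (le_trans xle); rewrite EFinD leeD2r //.
by apply: ge_ereal_sup => _ [t Dt <-]; rewrite lee_fin hM0.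
Qed.

Lemma supnorm_cvg0 (R : realType) (n : nat) (nrm : 'rV[R]_n -> R)
    (hnrm : is_norm nrm) (z : nat -> nat -> 'rV[R]_n) (K r : R) :
  0 < r < 1 -> (forall N i, nrm (z N i) <= K * r ^+ N.+1) ->
  supnorm nrm setT (z N) @[N --> \oo] --> 0%E.
Proof.
move=> /andP[r0 r1] zK.
apply: (@squeeze_cvge _ _ _ _ (fun=> 0%E) _ (fun N => (K * r * r ^+ N)%:E)).
- apply: nearW => N; apply/andP; split.
    apply: (@le_trans _ _ (nrm (z N 0))%:E).
      by rewrite lee_fin (nrm_ge0 hnrm).
    by apply: ereal_sup_ubound; exists 0.
  apply: ge_ereal_sup => _ [i _ <-].
  by rewrite lee_fin (le_trans (zK N i)) // exprS mulrA.
- exact: cvg_cst.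
- apply: cvg_EFin; first exact: nearW.
  by apply: cvg_geometric; rewrite gtr0_norm.
Qed.

Theorem theorem3p2 (R : realType) (n : nat)
  (nrm : 'rV[R]_n -> R) (hnrm : is_norm nrm)
  (h : R) (h_gt0 : 0 < h)
  (alpha1 alpha2 beta gamma : R)
  (halpha1 : alpha1 != 0) (halpha2 : 0 <= alpha2)
  (halpha12 : alpha1 <= alpha2)
  (hbeta : 0 < beta) (hbetagamma : gamma <= beta)
  (x0 : R -> 'rV[R]_n)
  (f g : R -> R -> 'rV[R]_n -> 'rV[R]_n)
  (Lf Lg Cf Cg : R) (S : set 'rV[R]_n)
  (hLf0 : 0 <= Lf) (hLg0 : 0 <= Lg)
  (hLf : lipschitz_in_x nrm lower_dom S f Lf)
  (hLg : lipschitz_in_x nrm upper_dom S g Lg)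
  (hL : Lf / `|alpha1| + Lg / beta < 1)
  (hfcont : continuous_kernel lower_dom S f)
  (hgcont : continuous_kernel upper_dom S g)
  (hCf : forall t s x, lower_dom (t, s) -> S x -> nrm (f t s x) <= Cf)
  (hCg : forall t s x, upper_dom (t, s) -> S x -> nrm (g t s x) <= Cg)
  (hS : S = [set x | ((nrm x)%:E <= supnorm nrm [set t : R | (0 <= t)%R] x0
                        + (Cf / `|alpha1| + Cg / beta)%:E)%E])
  (hfC1 : C1_bounded nrm lower_dom S f)
  (hgC1 : C1_bounded nrm upper_dom S g)
  (hx0bnd : bounded_on nrm [set t : R | (0 <= t)%R] x0)
  (hx0diff : differentiable_bounded nrm [set t : R | (0 <= t)%R] x0)
  (x : nat -> 'rV[R]_n) (hxS : forall i, S (x i))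
  (hx : solves alpha1 beta (fun i => x0 (i%:R * h))
          (omega alpha1 alpha2 h) (sample f h)
          (phi beta gamma h) (sample g h) x)
  (hbg : beta = gamma)
  (delta : R) (hdelta : 0 < delta)
  (hsg : Num.sg (alpha1 + delta) = Num.sg alpha1)
  (hbd : 0 < beta - delta) (hgd : 0 < gamma - delta)
  (htheta :
     Lf / `|alpha1| * ((expR (alpha1 * h) - 1)
                       / (expR ((alpha1 + delta) * h) - 1))
     + Lg / beta * ((1 - expR (- beta * h))
                    / (1 - expR (- (beta - delta) * h))) < 1) :
  let b_d := fun i => damp delta h i (x0 (i%:R * h)) in
  let omega_d := weight_damp delta h (omega alpha1 alpha2 h) in
  let phi_d := weight_damp delta h (phi beta gamma h) in
  let Phi := kernel_damp delta h (sample f h) in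
  let Psi := kernel_damp delta h (sample g h) in
  let y := fun i => damp delta h i (x i) in
  [/\ (forall i, S (undamp delta h i (y i))) /\
      solves alpha1 beta b_d omega_d Phi phi_d Psi y,
      (forall y' : nat -> 'rV[R]_n,
         (forall i, S (undamp delta h i (y' i))) ->
         solves alpha1 beta b_d omega_d Phi phi_d Psi y' -> y' = y)
    & forall yN : forall N : nat, 'I_N.+1 -> 'rV[R]_n,
        (forall N (i : 'I_N.+1), S (undamp delta h i (yN N i))) ->
        (forall N, solves_trunc alpha1 beta b_d omega_d Phi phi_d Psi (yN N)) ->
        supnorm nrm setT (fun i => extend0 (yN N) i - y i)
          @[N --> \oo] --> 0%E].
Proof.
move=> b_d omega_d phi_d Phi Psi y.
have [M SM] : exists M, forall x, S x -> nrm x <= M.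
  have [M hM] := bounded_state_ball (Cf / `|alpha1| + Cg / beta) hx0bnd.
  by exists M => v; rewrite hS /= => /hM.
pose D j := [set eta | S (undamp delta h j eta)].
have Dy j : D j (y j) by rewrite /D /= dampK.
have soly : solves alpha1 beta b_d omega_d Phi phi_d Psi y.
  exact: solves_damp.
have grid i j : (i <= j)%N -> 0 <= i%:R * h <= j%:R * h.
  by move=> ij; rewrite mulr_ge0 ?ler_pM2r ?ler_nat // ltW.
have lipPhi i j xi eta : (j < i)%N -> D j xi -> D j eta ->
    nrm (Phi i j xi - Phi i j eta) <= Lf * nrm (xi - eta).
  move=> ji; apply: kernel_damp_lip => // v v'; apply: hLf.
  by apply: grid; exact: ltnW.
have lipPsi i j xi eta : (i <= j)%N -> D j xi -> D j eta ->
    nrm (Psi i j xi - Psi i j eta) <= Lg * nrm (xi - eta).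
  move=> ij; apply: kernel_damp_lip => // v v'; apply: hLg.
  exact: grid.
set A := (expR (alpha1 * h) - 1) / _ in htheta.
set B := (1 - expR (- beta * h)) / _ in htheta.
have sum_omega i : \sum_(0 <= j < i) `|omega_d i j| <= A.
  exact: sum_omega_damp.
have sum_phi i m : \sum_(i <= j < m) `|phi_d i j| <= B.
  by rewrite /phi_d -hbg; exact: sum_phi_damp.
have M0 : 0 <= M by apply: le_trans (SM _ (hxS 0)); exact: nrm_ge0.
pose r := expR (- (delta * h)).
have r01 : 0 < r < 1 by exact: damp_ratio_itv.
have boundD j xi : D j xi -> nrm xi <= M.
  move=> Dxi; rewrite -(undampK delta h j xi).
  apply: le_trans (nrm_damp_le _ _ _ _ (leq0n j)) _ => //.
  by rewrite expr0 mul1r SM.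
have th_lt1 : Lf / `|alpha1| * A + Lg / `|beta| * B < 1.
  by rewrite (gtr0_norm hbeta).
split; first by split.
  move=> y' Dy' soly'.
  by apply: (solves_unique hnrm lipPhi lipPsi hLf0 hLg0 sum_omega sum_phi boundD
            th_lt1 Dy' Dy soly' soly).
move=> yN DyN solyN.
(* [Cg] is nonnegative because it bounds a norm at an actual state. *)
have Cg0 : 0 <= Cg.
  apply: le_trans (hCg (0%:R * h) (0%:R * h) _ _ (hxS 0)).
    exact: nrm_ge0.
  exact: grid.
set th := _ + _ in th_lt1.
(* [K] accounts for the rows [i <= N], and the bound [M] of [S] for the rows
   that the extension sets to zero. *)
pose K := B * Cg / `|beta| / (1 - th).
have B0 : 0 <= B by apply: le_trans (sum_phi 0%N 0%N); rewrite big_geq.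
have K0 : 0 <= K.
  apply: divr_ge0; last by rewrite subr_ge0 ltW.
  by apply: divr_ge0 => //; exact: mulr_ge0.
apply: (supnorm_cvg0 hnrm (K := K + M) r01) => N i.
have rN : 0 <= r ^+ N.+1 by rewrite exprn_ge0 ?expR_ge0.
have [iN|Ni] := leqP i N.
  have GT k j : (k <= N < j)%N -> nrm (Psi k j (y j)) <= r ^+ N.+1 * Cg.
    move=> /andP[kN Nj]; apply: le_trans (nrm_damp_le _ _ _ _ Nj) _ => //.
    rewrite ler_wpM2l // dampK hCg //.
    by apply: grid; exact: leq_trans kN (ltnW Nj).
  apply: (@le_trans _ _ (K * r ^+ N.+1)); last first.
    by rewrite ler_wpM2r // lerDl.
  rewrite (_ : K * _ = (B * (r ^+ N.+1 * Cg) / `|beta|) / (1 - th)); last first.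
    by rewrite /K; ring.
  have T0 : 0 <= r ^+ N.+1 * Cg by rewrite mulr_ge0.
  exact: (trunc_error hnrm lipPhi lipPsi hLf0 hLg0 sum_omega sum_phi boundD
            th_lt1 Dy (DyN N) soly (solyN N) T0 GT).
rewrite /extend0 insubN -?leqNgt // sub0r (nrmN hnrm).
apply: le_trans (nrm_damp_le _ _ _ _ Ni) _ => //.
by rewrite mulrC ler_wpM2r // ler_wpDl // SM.
Qed.
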